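(* The System Optimum Model is Pareto-conform: for any two alternatives $P_1,P_2$ with $P_1\preceq P_2$ we have $\mathcal{C}_{P_1}\le\mathcal{C}_{P_2}$.
   Context: Let $G=(V,E)$ be a directed graph, $s,t\in V$, $d>0$ rational. Every edge $e$ has a cost function $\tau_e:\mathbb{Q}_{\ge 0}\to\mathbb{Q}_{>0}$, monotonically increasing and differentiable; functions are considered on $[0,d]$ and inequalities between functions are pointwise on $[0,d]$. Paths are identified with edge sets; $\tau_A=\sum_{e\in A}\tau_e$ (zero if $A=\emptyset$), $\tau'_A$ its derivative. An original simple $s$–$t$ path $Q$ is fixed; an alternative is a simple $s$–$t$ path $P$, and $\mathcal{C}_P(x)=x\,\tau_{P\setminus Q}(x)+(d-x)\,\tau_{Q\setminus P}(d-x)+d\,\tau_{P\cap Q}(d)$ for $x\in[0,d]$. A psychological model assigns to each alternative $P$ a value $x_P\in[0,d]$, and $\mathcal{C}_P:=\mathcal{C}_P(x_P)$. In the System Optimum Model, $x_P\in[0,d]$ is a minimizer of $\mathcal{C}_P(x)$ over $[0,d]$. Dominance: $P_1\preceq P_2$ iff $\tau_{P_1}\le\tau_{P_2}$ and $\tau'_{P_1\cap Q}\le\tau'_{P_2\cap Q}$ on $[0,d]$. A model is Pareto-conform if $P_1\preceq P_2$ implies $\mathcal{C}_{P_1}\le\mathcal{C}_{P_2}$.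
   Formalization: Cost functions are taken to be increasing and differentiable in a nonnegative real variable (with positive rational values at rationals), and dominance and minimizers range over the real interval [0,d]; with functions on the rationals alone the claim fails. *)

(* Defs.v *)
From HB Require Import structures.
From mathcomp Require Import all_boot all_order all_algebra.
From mathcomp Require Import all_classical all_reals all_analysis.
Set Implicit Arguments.
Unset Strict Implicit.
Unset Printing Implicit Defensive.
Import Order.TTheory GRing.Theory Num.Theory.
Import numFieldNormedType.Exports.
Local Open Scope classical_set_scope.
Local Open Scope ring_scope.

(* Parallel edges and loops are allowed. *)
Record digraph := Digraph {
  vertex : finType;
  edge : finType;
  src : edge -> vertex;
  tgt : edge -> vertex }.

Section Paths.
Variable G : digraph.

Fixpoint walk (u : vertex G) (p : seq (edge G)) (v : vertex G) : bool :=
  if p is e :: p' then (src e == u) && walk (tgt e) p' v else u == v.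

(* A simple path is identified with its set of edges; [u :: map tgt p] is the
   list of the vertices visited by the walk [p] from [u]. *)
Definition simple_path (u v : vertex G) (A : {set edge G}) : Prop :=
  exists p : seq (edge G),
    [/\ walk u p v, uniq (u :: map (@tgt G) p) & A = [set e in p]%SET].

End Paths.

Section Derivative.
Variable R : realType.

(* Derivatives of functions with domain [0, +oo[: difference quotients are only
   taken at nonnegative points, so that the derivative is two-sided at x > 0 and
   one-sided at 0, and the values at negative reals are irrelevant. *)
Definition diff_quot (f : R -> R) (x y : R) : R := (f y - f x) / (y - x).

Definition nneg_derivable (f : R -> R) (x : R) : Prop :=
  cvg (diff_quot f x @ within [set y | 0 <= y] x^').

Definition nneg_derive (f : R -> R) (x : R) : R :=
  lim (diff_quot f x @ within [set y | 0 <= y] x^').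

(* Cost functions map nonnegative rationals to positive rationals, while
   monotonicity and differentiability are those of a function of a nonnegative
   real variable: over the rationals alone the derivative would not control the
   increments (there is no mean value theorem). Monotonicity is not strict, and
   implies positivity at every nonnegative real. *)
Definition cost_function (f : R -> R) : Prop :=
  [/\ forall q : rat, 0 <= q -> exists2 r : rat, 0 < r & f (ratr q) = ratr r,
      forall x y : R, 0 <= x -> x <= y -> f x <= f y
    & forall x : R, 0 <= x -> nneg_derivable f x].

End Derivative.

Section Models.
Variables (R : realType) (G : digraph) (s t : vertex G) (d : R).
Variables (tau : edge G -> R -> R) (Q : {set edge G}).

Definition set_cost (A : {set edge G}) (x : R) : R := \sum_(e in A) tau e x.

Definition alternative (P : {set edge G}) : Prop := simple_path s t P.

Definition overall_cost (P : {set edge G}) (x : R) : R :=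
  x * set_cost (P :\: Q)%SET x
  + (d - x) * set_cost (Q :\: P)%SET (d - x)
  + d * set_cost (P :&: Q)%SET d.

Definition dominates (P1 P2 : {set edge G}) : Prop :=
  forall x : R, 0 <= x <= d ->
    set_cost P1 x <= set_cost P2 x /\
    nneg_derive (set_cost (P1 :&: Q)%SET) x
      <= nneg_derive (set_cost (P2 :&: Q)%SET) x.

(* A model is represented by a function giving the value x_P for each edge set
   P; only its values at alternatives matter. *)
Definition psychological_model (xi : {set edge G} -> R) : Prop :=
  forall P : {set edge G}, alternative P -> 0 <= xi P <= d.

Definition system_optimum_model (xi : {set edge G} -> R) : Prop :=
  psychological_model xi /\
  forall P : {set edge G}, alternative P ->
    forall y : R, 0 <= y <= d -> overall_cost P (xi P) <= overall_cost P y.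

Definition pareto_conform (xi : {set edge G} -> R) : Prop :=
  forall P1 P2 : {set edge G}, alternative P1 -> alternative P2 ->
    dominates P1 P2 -> overall_cost P1 (xi P1) <= overall_cost P2 (xi P2).

End Models.

(* Main.v *)
(* C_{P2}(x) - C_{P1}(x) equals x (tau_{P2}(x) - tau_{P1}(x)) plus
   x (h(d) - h(x)) + (d - x) (h(d) - h(d - x)), where
   h = tau_{P2 :&: Q} - tau_{P1 :&: Q}. By the second half of dominance h' is
   nonnegative, so h is nondecreasing on [0, d] and all summands are
   nonnegative. Evaluating at the minimizer x_{P2} gives
   C_{P1}(x_{P1}) <= C_{P1}(x_{P2}) <= C_{P2}(x_{P2}). *)
Require Import Defs.
From HB Require Import structures.
From mathcomp Require Import all_boot all_order all_algebra.
From mathcomp Require Import all_classical all_reals all_analysis.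
From mathcomp Require Import ring lra.
Import Order.TTheory GRing.Theory Num.Theory.
Import numFieldNormedType.Exports.
Local Open Scope ring_scope.

Section NonnegativeDerivative.
Local Open Scope classical_set_scope.
Context {R : realType}.
Implicit Types (f : R -> R) (x : R).

(** Every point close to a positive [x] is itself nonnegative, so away from 0 the restricted
    derivative is the ordinary one. *)
Lemma within_nneg_dnbhs x : 0 < x -> within [set y : R | 0 <= y] x^' = x^'.
Proof.
move=> x0; apply/seteqP; split => A /=; last exact: cvg_within.
have x_ge0 : \forall y \near x^', 0 <= y.
  by apply: nbhs_dnbhs; near do apply: ltW; exact: lt_nbhsr.
by move=> wA; apply: filterS2 x_ge0 wA => y y0; apply.
Unshelve. all: by end_near. Qed.

(** Substitute $y = x + h$; the right-hand side is the quotient behind [derivable f x 1] and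
    ['D_1 f x]. *)
Lemma diff_quot_dnbhs f x :
  diff_quot f x @ x^' =
    (h^-1 *: ((f \o shift x) (h *: 1) - f x) @[h --> 0^']).
Proof.
apply/funext => A.
apply: etrans (near_shift 0 x (fun y => y != x -> A (diff_quot f x y))) _.
congr (nbhs _ _); apply/funext => h /=.
by rewrite subr0 scaler1 /diff_quot addrK -subr_eq0 addrK mulrC.
Qed.

Lemma nneg_derivable1 f x : 0 < x -> nneg_derivable f x -> derivable f x 1.
Proof.
move=> x0; rewrite /nneg_derivable (within_nneg_dnbhs _ x0) diff_quot_dnbhs.
exact: id.
Qed.

Lemma nneg_derive1E f x : 0 < x -> nneg_derive f x = 'D_1 f x.
Proof.
by move=> x0; rewrite /nneg_derive (within_nneg_dnbhs _ x0) diff_quot_dnbhs.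
Qed.

(** For $y \ne x$, $f(y)$ is the difference quotient times $y - x$, plus $f(x)$; the product tends
    to $l \cdot 0$. This includes one-sided continuity at 0. *)
Lemma nneg_derivable_continuous f :
  (forall x, 0 <= x -> nneg_derivable f x) ->
  {within [set x : R | 0 <= x], continuous f}.
Proof.
move=> df; apply/subspace_continuousP => x /= x0.
have /cvg_ex[l fl] := df x x0.
set F := within _ _ in fl.
have xF : y @[y --> F] --> x.
  by apply: cvg_within_filter; apply: cvg_within_filter; exact: cvg_id.
have : diff_quot f x y * (y - x) + f x @[y --> F] --> l * (x - x) + f x.
  by apply: cvgD; [apply: cvgM => //; apply: cvgB => //|]; exact: cvg_cst.
rewrite subrr mulr0 add0r => cF A fA.
have wA : \forall y \near x, y != x -> 0 <= y ->
  A (diff_quot f x y * (y - x) + f x) by exact: (cF A fA).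
suff : \forall y \near x, 0 <= y -> A (f y) by [].
(* The punctured limit says nothing at [y = x], where [A (f x)] holds because [A] is a neighbourhood
   of [f x]. *)
apply: filterS wA => y + y0; have [-> _|yx /(_ isT y0)] := eqVneq y x.
  exact: nbhs_singleton.
by rewrite /diff_quot divfK ?subr_eq0// subrK.
Qed.

End NonnegativeDerivative.

Section SetCost.
Local Open Scope classical_set_scope.
Context {R : realType} {G : digraph} {tau : edge G -> R -> R}.
Hypothesis dtau : forall e x, 0 <= x -> nneg_derivable (tau e) x.
Implicit Types A B : {set edge G}.

(** As a sum of functions, the cost inherits derivability and continuity from single edges through
    [big_ind]. *)
Lemma set_costE A : set_cost tau A = \sum_(e in A) tau e.
Proof. by rewrite fct_sumE. Qed.

Lemma set_cost_derivable A x : 0 < x -> derivable (set_cost tau A) x 1.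
Proof.
move=> x0; rewrite set_costE; apply: (big_ind (fun f => derivable f x 1)).
- exact: derivable_cst.
- by move=> f g df dg; exact: derivableD.
- by move=> e _; apply: nneg_derivable1 => //; apply: dtau; exact: ltW.
Qed.

Lemma set_cost_continuous A :
  {within [set x : R | 0 <= x], continuous (set_cost tau A)}.
Proof.
rewrite set_costE.
apply: (big_ind (fun f : R -> R => {within [set x : R | 0 <= x], continuous f})).
- by apply: continuous_subspaceT => x; exact: cvg_cst.
- by move=> f g cf cg; exact: within_continuousD.
- by move=> e _; apply: nneg_derivable_continuous; exact: dtau.
Qed.

(** The difference of the two costs has nonnegative derivative, hence is nondecreasing. Ordinary
    derivatives are needed only inside $(0,d)$; the endpoints are covered by continuity. *)
Lemma set_cost_increment_le A B (d : R) :
  (forall x, 0 <= x <= d ->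
    nneg_derive (set_cost tau A) x <= nneg_derive (set_cost tau B) x) ->
  forall x, 0 <= x <= d ->
    set_cost tau A d - set_cost tau A x <= set_cost tau B d - set_cost tau B x.
Proof.
move=> dAB x /andP[x0 xd]; have d0 := le_trans x0 xd.
suff : (set_cost tau B - set_cost tau A) x <= (set_cost tau B - set_cost tau A) d.
  by rewrite !fctE; lra.
apply: (@ger0_derive1_le_cc _ _ 0 d) => //; rewrite ?in_itv/= ?x0 ?d0 ?lexx//.
- move=> y; rewrite in_itv/= => /andP[y0 _].
  by apply: derivableB; exact: set_cost_derivable.
- move=> y; rewrite in_itv/= => /andP[y0 yd].
  rewrite derive1E deriveB; [|exact: set_cost_derivable..].
  rewrite -!nneg_derive1E// subr_ge0.
  by apply: dAB; rewrite !ltW.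
- apply: (@continuous_subspaceW _ _ _ [set y : R | 0 <= y]).
    by move=> y /=; rewrite in_itv/= => /andP[].
  by apply: within_continuousB; exact: set_cost_continuous.
Qed.

Lemma set_costID A B x :
  set_cost tau A x = set_cost tau (A :&: B)%SET x + set_cost tau (A :\: B)%SET x.
Proof. by rewrite /set_cost (big_setID B). Qed.

Lemma overall_cost_le (d : R) (Q P1 P2 : {set edge G}) x :
  dominates d tau Q P1 P2 -> 0 <= x <= d ->
  overall_cost d tau Q P1 x <= overall_cost d tau Q P2 x.
Proof.
move=> dom xd; have /andP[x0 xled] := xd.
have dx0 : 0 <= d - x by rewrite subr_ge0.
have dxd : 0 <= d - x <= d by rewrite dx0 gerBl.
have incr := @set_cost_increment_le _ _ d (fun y yd => proj2 (dom y yd)).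
have [leP _] := dom x xd.
(* The inequalities are grouped by their factors $x$ and $d - x$. *)
have := ler_wpM2l x0 (lerD leP (incr x xd)).
have := ler_wpM2l dx0 (incr (d - x) dxd).
rewrite /overall_cost.
rewrite (set_costID P1 Q x) (set_costID P2 Q x).
(* Splitting $\tau_Q(d-x)$ along [P1] and along [P2] gives two equal sums. Their equality is needed
   multiplied by $d - x$, so one term is substituted away before [lra]. *)
have := set_costID Q P1 (d - x); have := set_costID Q P2 (d - x).
rewrite !(finset.setIC Q) => -> /eqP; rewrite eq_sym addrC -subr_eq => /eqP <-.
by lra.
Qed.

End SetCost.

Theorem theorem11 (R : realType) (G : digraph) (s t : vertex G) (d : rat)
    (tau : edge G -> R -> R) (Q : {set edge G}) (xi : {set edge G} -> R) :
  0 < d ->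
  (forall e : edge G, cost_function (tau e)) ->
  simple_path s t Q ->
  system_optimum_model s t (ratr d : R) tau Q xi ->
  pareto_conform s t (ratr d : R) tau Q xi.
Proof.
move=> _ ctau _ [xi_itv xi_min] P1 P2 altP1 altP2 dom.
have xi2 := xi_itv P2 altP2.
(* [xi P2] competes in the minimization for [P1], as the interval is the same for all
   alternatives. *)
apply: le_trans (xi_min P1 altP1 _ xi2) _.
by apply: overall_cost_le => // e; have [] := ctau e.
Qed.
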